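(* Let $G$ be a finite simple graph with vertex set $\{x_1,\ldots,x_n\}$, let $G_0=G$ and let $G_r=C(G_{r-1})$ be the cone over $G_{r-1}$ for $r\geq 1$. Suppose that the vector $\alpha=(1,\ldots,1,-g)\in\mathbb{Z}^{n+1}$, $g\in\mathbb{N}$, is one of the vectors $\alpha_1,\ldots,\alpha_p$ occurring in the irreducible representation of the Rees cone $\mathbb{R}_+(I_c(G))$. Then for every $r\geq 1$ the vector $$(\underbrace{1,\ldots,1}_{n},\underbrace{n-g,\ldots,n-g}_{r})$$ is an irreducible $(n+(r-1)(n-g))$-cover of $\Upsilon(G_r)$. In particular $R_s(I(G_r))$ has a minimal generator (as a $K$-algebra) of degree in $t$ equal to $n+(r-1)(n-g)$.
   Context: $\mathbb{N}=\{0,1,2,\ldots\}$ and $K$ is a field. The cone $C(G)$ over $G$ is the graph obtained by adding a new vertex to $G$ and joining it to every vertex of $G$; in $G_r$ the new vertices are listed, in order, as $x_{n+1},\ldots,x_{n+r}$. A vertex cover of a graph is a set of vertices meeting every edge; $\Upsilon(G)$ is the family of (inclusion-)minimal vertex covers of $G$. For a graph $H$ with vertices $x_1,\ldots,x_m$, $0\neq a\in\mathbb{N}^m$ and $b\in\mathbb{N}$, $a$ is a $b$-cover of $\Upsilon(H)$ if $\sum_{x_i\in C}a_i\geq b$ for every $C\in\Upsilon(H)$; it is reducible if $a=c+d$ with $c$ an $i$-cover and $d$ a $j$-cover of $\Upsilon(H)$ (covers are nonzero vectors by definition), $i,j\in\mathbb{N}$, $i+j=b$, and irreducible otherwise. Let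 $u_1,\ldots,u_s\in\{0,1\}^n$ be the incidence vectors of the minimal vertex covers of $G$. The ideal of vertex covers $I_c(G)$ is generated by $x^{u_1},\ldots,x^{u_s}$, and its Rees cone $\mathbb{R}_+(I_c(G))\subset\mathbb{R}^{n+1}$ is the cone of nonnegative real combinations of $e_1,\ldots,e_n,(u_1,1),\ldots,(u_s,1)$; it has dimension $n+1$. There is a unique irreducible representation $$\mathbb{R}_+(I_c(G))=H_{e_1}^+\cap\cdots\cap H_{e_{n+1}}^+\cap H_{\alpha_1}^+\cap\cdots\cap H_{\alpha_p}^+$$ where $H_c^+=\{y\mid\langle y,c\rangle\geq 0\}$, each $\alpha_k\in\mathbb{Z}^{n+1}$ has relatively prime nonzero entries, and none of the closed halfspaces can be omitted. That is, $\alpha_1,\ldots,\alpha_p$ are the primitive integral inner normal vectors of the facets of the cone other than those lying in coordinate hyperplanes. For a graph $H$ with vertices $x_1,\ldots,x_m$, the edge ideal $I(H)\subset R=K[x_1,\ldots,x_m]$ is generated by all $x_ix_j$ with $\{x_i,x_j\}\in E(H)$; $I(H)^{(i)}=\mathfrak{p}_1^i\cap\cdots\cap\mathfrak{p}_s^i$, where $\mathfrak{p}_1,\ldots,\mathfrak{p}_s$ are the minimal primes of $I(H)$, and $R_s(I(H))=\bigoplus_{i\geq 0}I(H)^{(i)}t^i\subset R[t]$ (with $I(H)^{(0)}=R$). Its minimal generators as a $K$-algebra are the monomials $\neq 1$ in it that are not a product of two monomials $\neq 1$ of $R_s(I(H))$. *)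

(* Defs.v *)
(* Mathematical Components, with multinomials ({mpoly K[m]}) and the type of
   real numbers (realType) of MathComp-Analysis. *)
From mathcomp Require Import all_boot all_order all_algebra.
From mathcomp Require Import ring_quotient mpoly reals.

Set Implicit Arguments.
Unset Strict Implicit.
Unset Printing Implicit Defensive.

Import Order.TTheory GRing.Theory Num.Theory.

Local Open Scope ring_scope.

(* [symmetric] alone would be the notion for multivariate polynomials. *)
Record sgraph (n : nat) := SGraph {
  adj :> rel 'I_n;
  adj_sym : ssrbool.symmetric adj;
  adj_irr : irreflexive adj
}.

(* [None] is the apex: it is adjacent to every vertex but itself. *)
Definition cone_rel n (e : rel 'I_n) : rel 'I_n.+1 := fun i j =>
  match unlift ord_max i, unlift ord_max j with
  | Some i', Some j' => e i' j'
  | None, None => false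
  | _, _ => true
  end.

Lemma cone_rel_sym n (e : rel 'I_n) :
  ssrbool.symmetric e -> ssrbool.symmetric (cone_rel e).
Proof.
move=> es i j; rewrite /cone_rel.
by case: (unlift _ i) => [i'|]; case: (unlift _ j) => [j'|].
Qed.

Lemma cone_rel_irr n (e : rel 'I_n) :
  irreflexive e -> irreflexive (cone_rel e).
Proof. by move=> ei i; rewrite /cone_rel; case: (unlift _ i). Qed.

Definition cone n (G : sgraph n) : sgraph n.+1 :=
  SGraph (cone_rel_sym (@adj_sym n G)) (cone_rel_irr (@adj_irr n G)).

(* The vertices of [iter_cone G r] with index < n are those of G, and the
   apices follow in the order in which they are added (r.+1 + n is convertible
   to (r + n).+1). *)
Fixpoint iter_cone n (G : sgraph n) (r : nat) : sgraph (r + n) :=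
  match r with
  | 0%N => G
  | r'.+1 => cone (iter_cone G r')
  end.

Definition vertex_cover n (G : sgraph n) (C : {set 'I_n}) : bool :=
  [forall i, forall j, G i j ==> (i \in C) || (j \in C)].

Definition min_covers n (G : sgraph n) : {set {set 'I_n}} :=
  [set C | minset (vertex_cover G) C].

Definition is_cover n (G : sgraph n) (b : nat) (a : 'X_{1..n}) : Prop :=
  a <> 0%MM /\
  forall C, C \in min_covers G -> (b <= \sum_(i in C) a i)%N.

Definition reducible_cover n (G : sgraph n) (b : nat) (a : 'X_{1..n}) : Prop :=
  exists (c d : 'X_{1..n}) (i j : nat),
    [/\ a = (c + d)%MM, is_cover G i c, is_cover G j d & (i + j = b)%N].

Definition irreducible_cover n (G : sgraph n) (b : nat) (a : 'X_{1..n}) :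
  Prop := is_cover G b a /\ ~ reducible_cover G b a.

Definition incidence (R : realType) n (C : {set 'I_n}) : 'rV[R]_n :=
  \row_i (i \in C)%:R.

Definition rees_cone (R : realType) n (G : sgraph n) (y : 'rV[R]_(n + 1)) :
  Prop :=
  exists (a : 'I_n -> R) (b : {set 'I_n} -> R),
    [/\ forall i, 0 <= a i,
        forall C, C \in min_covers G -> 0 <= b C
      & y = \sum_i a i *: row_mx (delta_mx 0 i) 0
            + \sum_(C in min_covers G)
                b C *: row_mx (incidence R C) (const_mx 1)].

Definition halfspace (R : realType) m (c : 'rV[int]_m) (y : 'rV[R]_m) : Prop :=
  0 <= \sum_j y 0 j * (c 0 j)%:~R.

Definition normals m p (alpha : 'I_p -> 'rV[int]_m) (k : 'I_m + 'I_p) :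
  'rV[int]_m :=
  match k with
  | inl j => delta_mx 0 j
  | inr l => alpha l
  end.

(* Zero entries do not affect the gcd. *)
Definition primitive m (c : 'rV[int]_m) : Prop :=
  \big[gcdn/0%N]_j `|c 0%R j|%N = 1%N.

Definition irreducible_representation (R : realType) n (G : sgraph n) p
    (alpha : 'I_p -> 'rV[int]_(n + 1)) : Prop :=
  [/\ forall l, primitive (alpha l),
      forall y : 'rV[R]_(n + 1),
        rees_cone G y <-> (forall k, halfspace (normals alpha k) y)
    & forall k0, ~ (forall y : 'rV[R]_(n + 1),
        rees_cone G y <->
        (forall k, k <> k0 -> halfspace (normals alpha k) y))].

(* The truncated subtraction is harmless when (1, ..., 1, -g) is the normal of
   a halfspace of the irreducible representation: g is then the least size of
   a vertex cover, so that g <= n. *)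
Definition cone_vector (n g r : nat) : 'X_{1..r + n} :=
  [multinom (if (i < n)%N then 1%N else (n - g)%N) | i < r + n].

Definition ideal_gen (A : comNzRingType) (S : A -> Prop) (f : A) : Prop :=
  exists s : seq (A * A),
    (forall x, x \in s -> S x.2) /\ f = \sum_(x <- s) x.1 * x.2.

Definition ideal_pow (A : comNzRingType) (P : {pred A}) (i : nat) :
  A -> Prop :=
  ideal_gen (fun f => exists t : 'I_i -> A,
    (forall k, t k \in P) /\ f = \prod_k t k).

(* [idealr_closed] is the notion of a proper ideal. *)
Definition prime_over (A : comNzRingType) (I : A -> Prop) (P : {pred A}) :
  Prop :=
  [/\ idealr_closed P, prime_idealr_closed P & forall f, I f -> f \in P].

Definition minimal_prime (A : comNzRingType) (I : A -> Prop) (P : {pred A}) :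
  Prop :=
  prime_over I P /\
  forall Q : {pred A}, prime_over I Q -> {subset Q <= P} -> {subset P <= Q}.

Definition edge_ideal (K : fieldType) m (H : sgraph m) : {mpoly K[m]} -> Prop :=
  ideal_gen (fun f => exists i j, H i j /\ f = 'X_i * 'X_j).

(* Only the minimal primes enter: this is the symbolic power for ideals without
   embedded primes, such as edge ideals. *)
Definition symbolic_power (A : comNzRingType) (I : A -> Prop) (i : nat)
    (f : A) : Prop :=
  forall P : {pred A}, minimal_prime I P -> ideal_pow P i f.

(* R[t] is {poly R}, where R = {mpoly K[m]}. *)
Definition symbolic_rees (K : fieldType) m (H : sgraph m)
    (f : {poly {mpoly K[m]}}) : Prop :=
  forall i, symbolic_power (edge_ideal (K := K) H) i f`_i.

Definition is_monomial (K : fieldType) m (f : {poly {mpoly K[m]}}) : Prop :=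
  exists (a : 'X_{1..m}) (b : nat), f = ('X_[a] : {mpoly K[m]}) *: 'X^b.

Definition rees_monomial (K : fieldType) m (H : sgraph m)
    (f : {poly {mpoly K[m]}}) : Prop :=
  [/\ is_monomial f, f <> 1 & symbolic_rees H f].

Definition min_generator (K : fieldType) m (H : sgraph m)
    (f : {poly {mpoly K[m]}}) : Prop :=
  rees_monomial H f /\
  ~ exists g h, [/\ rees_monomial H g, rees_monomial H h & f = g * h].

(* Main.v *)
(* The facet of the Rees cone with normal (1, ..., 1, -g) is spanned by the
   vectors (u_C, 1) for the minimal covers C of size g, so a functional which is
   constant on the u_C is a multiple of (1, ..., 1). The minimal covers of G_r
   are the covers C plus all apices, and the complements of single apices; all
   of them are tight on the vector a = (1, ..., 1, n-g, ..., n-g) as soon as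
   |C| = g. If a = c + d is a sum of covers of total degree b, these covers are
   tight on c and d too. The base part of c, a 0-1 vector, is thus constant, so
   the base part of c or of d vanishes, and then tightness kills its apex part.
   Finally, x^a t^b lies in the symbolic Rees algebra iff a satisfies the
   inequalities of a b-cover, because the minimal primes of the edge ideal are
   generated by the minimal covers. *)
Require Import Defs.
From mathcomp Require Import all_boot all_order all_algebra.
From mathcomp Require Import mpoly reals.
From mathcomp Require Import ring lra zify.

Set Implicit Arguments.
Unset Strict Implicit.
Unset Printing Implicit Defensive.

Set Implicit Arguments.
Unset Strict Implicit.
Unset Printing Implicit Defensive.

Import Order.TTheory GRing.Theory Num.Theory.

Local Open Scope ring_scope.

(** * The facet of the Rees cone *)

(** [halfspace] says that this form is nonnegative; naming it makes its linearity in [y]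
    available. *)
Definition pairing (R : realType) m (y : 'rV[R]_m) (c : 'rV[int]_m) : R :=
  \sum_j y 0 j * (c 0 j)%:~R.

Lemma pairingD (R : realType) m (y z : 'rV[R]_m) c :
  pairing (y + z) c = pairing y c + pairing z c.
Proof.
by rewrite /pairing -big_split; apply: eq_bigr => j _; rewrite mxE mulrDl.
Qed.

Lemma pairingZ (R : realType) m a (y : 'rV[R]_m) c :
  pairing (a *: y) c = a * pairing y c.
Proof.
by rewrite /pairing mulr_sumr; apply: eq_bigr => j _; rewrite mxE mulrA.
Qed.

Lemma pairing0 (R : realType) m (c : 'rV[int]_m) : pairing (0 : 'rV[R]_m) c = 0.
Proof. by rewrite -(scale0r 0) pairingZ mul0r. Qed.

Lemma pairing_sum (R : realType) m (I : finType) (P : pred I)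
    (y : I -> 'rV[R]_m) c :
  pairing (\sum_(i | P i) y i) c = \sum_(i | P i) pairing (y i) c.
Proof.
by apply: (big_morph (fun y => pairing y c)) => [u v|];
  rewrite ?pairingD ?pairing0.
Qed.

(* The segment from [y], which violates only the inequality [k0], to the
   interior point [z] crosses the hyperplane [N k0] inside the cone, and so do
   the segments to the points near [z]: the crossing points span the
   hyperplane. *)
Lemma facet_rigid (R : realType) (I : finType) m (N : I -> 'rV[int]_m)
    (k0 : I) (d : 'rV[int]_m) (y z : 'rV[R]_m) :
  (forall k, 0 < pairing z (N k)) ->
  (forall k, k <> k0 -> 0 <= pairing y (N k)) ->
  pairing y (N k0) < 0 ->
  (forall x : 'rV[R]_m, (forall k, 0 <= pairing x (N k)) ->
     pairing x (N k0) = 0 -> pairing x d = 0) ->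
  forall h : 'rV[R]_m, pairing h (N k0) = 0 -> pairing h d = 0.
Proof.
move=> zpos yge ylt vanish h h0.
(* [M] is so large that [z + M^-1 *: h] still satisfies every inequality; the summand 1 keeps it
   positive when all pairings with [h] vanish. *)
pose M := 1 + \sum_k `|pairing h (N k)| / pairing z (N k).
have Mk k : `|pairing h (N k)| <= M * pairing z (N k).
  rewrite -ler_pdivrMr // /M (bigD1 k) //=.
  have: 0 <= \sum_(i | i != k) `|pairing h (N i)| / pairing z (N i).
    by apply: sumr_ge0 => i _; rewrite divr_ge0 // ltW.
  by lra.
have Mgt0 : 0 < M.
  rewrite /M ltr_pwDl // sumr_ge0 // => i _; rewrite divr_ge0 //; exact: ltW.
set u := pairing z (N k0); set w := - pairing y (N k0).
have ugt0 : 0 < u by exact: zpos.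
have wgt0 : 0 < w by rewrite oppr_gt0.
(* [u *: y + w *: x] is a positive multiple of the point where the segment from [y] to [x] meets the
   hyperplane. *)
have crossing (x : 'rV[R]_m) : pairing x (N k0) = u ->
    (forall k, 0 <= pairing x (N k)) -> pairing (u *: y + w *: x) d = 0.
  move=> xu xge; apply: vanish => [k|]; last first.
    by rewrite pairingD !pairingZ xu /w; ring.
  rewrite pairingD !pairingZ; have [->|/eqP kk0] := eqVneq k k0.
    by rewrite xu /w mulNr mulrC subrr.
  by rewrite addr_ge0 // mulr_ge0 ?yge ?xge ?(ltW ugt0) ?(ltW wgt0).
have ez := crossing z erefl (fun k => ltW (zpos k)).
have eh : pairing (u *: y + w *: (z + M^-1 *: h)) d = 0.
  apply: crossing => [|k]; first by rewrite pairingD pairingZ h0 mulr0 addr0.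
  rewrite pairingD pairingZ -(pmulr_rge0 _ Mgt0) mulrDr mulrA divff ?gt_eqF //.
  by have /ler_normlP[+ _] := Mk k; rewrite mul1r; lra.
(* The two crossing points differ by [w / M] times [h]. *)
move: eh; rewrite scalerDr addrA pairingD ez add0r !pairingZ => /eqP.
by rewrite !mulf_eq0 invr_eq0 (gt_eqF wgt0) (gt_eqF Mgt0) => /eqP.
Qed.

(** The value of the functional [c] on the generator (u_C, 1), kept in [int] so that it does not
    depend on [R]. *)
Definition ray_sum (n : nat) (c : 'rV[int]_(n + 1)) (C : {set 'I_n}) : int :=
  \sum_(i in C) c 0 (lshift 1 i) + c 0 (rshift n ord0).

Lemma pairing_lshift (R : realType) n (c : 'rV[int]_(n + 1)) (x : 'rV[R]_n)
    (t : R) :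
  pairing (row_mx x (const_mx t)) c =
  \sum_i x 0 i * (c 0 (lshift 1 i))%:~R + t * (c 0 (rshift n ord0))%:~R.
Proof.
rewrite /pairing big_split_ord /= big_ord1 row_mxEr mxE; congr (_ + _).
by apply: eq_bigr => i _; rewrite row_mxEl.
Qed.

Lemma pairing_axis (R : realType) n (c : 'rV[int]_(n + 1)) (i : 'I_n) :
  pairing (row_mx (delta_mx 0 i) 0 : 'rV[R]_(n + 1)) c = (c 0 (lshift 1 i))%:~R.
Proof.
have -> : 0 = const_mx 0 :> 'rV[R]_1 by [].
rewrite pairing_lshift mul0r addr0 (bigD1 i) //= big1 => [|j jne].
  by rewrite mxE !eqxx mul1r addr0.
by rewrite mxE eqxx (negbTE jne) mul0r.
Qed.

Lemma pairing_ray (R : realType) n (c : 'rV[int]_(n + 1)) (C : {set 'I_n}) :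
  pairing (row_mx (incidence R C) (const_mx 1)) c =
  (ray_sum c C)%:~R.
Proof.
rewrite pairing_lshift /ray_sum rmorphD rmorph_sum /= mul1r big_mkcond /=.
congr (_ + _); rewrite [RHS]big_mkcond /=; apply: eq_bigr => i _.
by rewrite mxE; case: (i \in C); rewrite ?mul1r ?mul0r.
Qed.

Lemma pairing_comb (R : realType) n (G : sgraph n) (c : 'rV[int]_(n + 1))
    (a : 'I_n -> R) (b : {set 'I_n} -> R) :
  pairing (\sum_i a i *: row_mx (delta_mx 0 i) 0
    + \sum_(C in min_covers G) b C *: row_mx (incidence R C) (const_mx 1)) c =
  \sum_i a i * (c 0 (lshift 1 i))%:~R +
  \sum_(C in min_covers G) b C * (ray_sum c C)%:~R.
Proof.
rewrite pairingD !pairing_sum; congr (_ + _); apply: eq_bigr => i _.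
  by rewrite pairingZ pairing_axis.
by rewrite pairingZ pairing_ray.
Qed.

Lemma rees_cone_axis (R : realType) n (G : sgraph n) (i : 'I_n) :
  rees_cone G (row_mx (delta_mx 0 i) 0 : 'rV[R]_(n + 1)).
Proof.
exists (fun j => (j == i)%:R), (fun=> 0); split=> //.
rewrite [X in _ + X]big1 ?addr0 => [|C _]; last by rewrite scale0r.
rewrite (bigD1 i) //= eqxx scale1r big1 ?addr0 // => j /negbTE ->.
by rewrite scale0r.
Qed.

Lemma rees_cone_ray (R : realType) n (G : sgraph n) (C : {set 'I_n}) :
  C \in min_covers G ->
  rees_cone G (row_mx (incidence R C) (const_mx 1)).
Proof.
move=> CG; exists (fun=> 0), (fun D => (D == C)%:R); split=> //.
rewrite big1 ?add0r => [|i _]; last by rewrite scale0r.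
rewrite (bigD1 C) //= eqxx scale1r big1 ?addr0 // => D /andP[_ /negbTE ->].
by rewrite scale0r.
Qed.

Lemma min_cover_sub n (G : sgraph n) (C : {set 'I_n}) : vertex_cover G C ->
  exists2 D, D \in min_covers G & D \subset C.
Proof. by case/minset_exists => D Dmin DC; exists D; rewrite // inE. Qed.

Lemma vertex_coverP n (G : sgraph n) (C : {set 'I_n}) :
  reflect (forall i j, G i j -> (i \in C) || (j \in C)) (vertex_cover G C).
Proof.
apply: (iffP forallP) => [H i j Gij|H i]; last first.
  by apply/forallP => j; apply/implyP; exact: H.
by have /forallP/(_ j)/implyP := H i; apply.
Qed.

Lemma min_covers_neq0 n (G : sgraph n) : exists C, C \in min_covers G.
Proof.
have /min_cover_sub[D DG _] : vertex_cover G setT.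
  by apply/vertex_coverP => i j; rewrite inE.
by exists D.
Qed.

Section Facet.

Variables (R : realType) (n p : nat) (G : sgraph n).
Variable alpha : 'I_p -> 'rV[int]_(n + 1).
Hypothesis Halpha : irreducible_representation R G alpha.

Lemma normals_axis_ge0 k i : 0 <= normals alpha k 0 (lshift 1 i).
Proof.
have [_ rep _] := Halpha.
have /(_ k) := (rep _).1 (rees_cone_axis R G i).
by rewrite /halfspace -/(pairing _ _) pairing_axis ler0z.
Qed.

Lemma normals_ray_ge0 k C : C \in min_covers G ->
  0 <= ray_sum (normals alpha k) C.
Proof.
have [_ rep _] := Halpha => /(rees_cone_ray R)/rep/(_ k).
by rewrite /halfspace -/(pairing _ _) pairing_ray ler0z.
Qed.

(** The sum of all generators works. Each normal is nonnegative on each generator, so a zero pairing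
    would make it vanish on all of them and hence be 0; but a coordinate normal is nonzero, and a
    zero [alpha l] would have gcd 0. *)
Lemma rees_cone_interior :
  exists z : 'rV[R]_(n + 1), forall k, 0 < pairing z (normals alpha k).
Proof.
exists (\sum_i 1 *: row_mx (delta_mx 0 i) 0
  + \sum_(C in min_covers G) 1 *: row_mx (incidence R C) (const_mx 1)) => k.
rewrite (pairing_comb G _ (fun=> 1) (fun=> 1)).
under eq_bigr do rewrite mul1r; under [X in _ + X]eq_bigr do rewrite mul1r.
rewrite -!rmorph_sum -rmorphD /= ltr0z lt0r.
have age : 0 <= \sum_i normals alpha k 0 (lshift 1 i).
  by apply: sumr_ge0 => i _; exact: normals_axis_ge0.
have rge : 0 <= \sum_(C in min_covers G) ray_sum (normals alpha k) C.
  by apply: sumr_ge0 => C; exact: normals_ray_ge0.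
rewrite addr_ge0 // andbT paddr_eq0 // !psumr_eq0; last 2 first.
- by move=> C; exact: normals_ray_ge0.
- by move=> i _; exact: normals_axis_ge0.
apply/negP => /andP[/allP a0 /allP r0].
have c0 i : normals alpha k 0 (lshift 1 i) = 0.
  exact/eqP/(implyP (a0 i (mem_index_enum _))).
have [C CG] := min_covers_neq0 G.
have {r0} := implyP (r0 C (mem_index_enum _)) CG.
rewrite /ray_sum big1 // add0r => /eqP cn.
have {c0 cn} n0 j : normals alpha k 0 j = 0.
  by case: (split_ordP j) => i ->; rewrite ?c0 // (ord1 i) cn.
case: k n0 {age rge a0} => [j|l] /= n0.
  by have := n0 j; rewrite mxE !eqxx.
have [/(_ l) + _ _] := Halpha; rewrite /primitive big1 // => j _.
by rewrite n0.
Qed.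

(** Irredundancy makes the face cut out by [alpha k] span its hyperplane, through [facet_rigid]. *)
Lemma facet_functional k (d : 'rV[int]_(n + 1)) :
  (forall x : 'rV[R]_(n + 1), rees_cone G x -> pairing x (alpha k) = 0 ->
     pairing x d = 0) ->
  forall h : 'rV[R]_(n + 1), pairing h (alpha k) = 0 -> pairing h d = 0.
Proof.
move=> vanish h hk; apply/eqP; apply: contraT => /eqP hd.
have [_ rep irr] := Halpha.
have [z zpos] := rees_cone_interior.
(* Irredundancy is a negation, so it yields no violating point directly. Instead, a point violating
   only the inequality [k] would contradict [hd], which makes that inequality redundant. *)
case: (irr (inr k)) => y; split=> [/rep yge l _|yge]; first exact: yge.
apply/rep => l; have [->|/eqP] := eqVneq l (inr k); last exact: yge.
rewrite /halfspace -/(pairing _ _) leNgt; apply/negP => ylt; apply: hd.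
apply: (@facet_rigid _ _ _ (normals alpha) (inr k) _ y z) => // x /rep.
exact: vanish.
Qed.

Variables (g : nat) (k : 'I_p).
Hypothesis Hk : alpha k = row_mx (const_mx 1) (const_mx (- g%:Z)).

Lemma ray_sum_facet C : ray_sum (alpha k) C = #|C|%:Z - g%:Z.
Proof.
rewrite /ray_sum Hk row_mxEr mxE; congr (_ + _).
rewrite -sum1_card -[RHS]natz natr_sum; apply: eq_bigr => i _.
by rewrite row_mxEl mxE.
Qed.

Lemma min_cover_size C : C \in min_covers G -> (g <= #|C|)%N.
Proof. by move/(normals_ray_ge0 (inr k)); rewrite /= ray_sum_facet subr_ge0. Qed.

(** On a point of the facet, every term of the generator expansion has a nonnegative pairing with
    [alpha k], so each is 0: the axes drop out, and only covers of size [g] keep a nonzero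
    coefficient. *)
Lemma facet_vanish (d : 'rV[int]_(n + 1)) :
  (forall C, C \in min_covers G -> #|C| = g -> ray_sum d C = 0) ->
  forall h : 'rV[R]_(n + 1), pairing h (alpha k) = 0 -> pairing h d = 0.
Proof.
move=> dC; apply: facet_functional => x [a [b [age bge ->]]].
rewrite !pairing_comb => /eqP.
have ak i : alpha k 0 (lshift 1 i) = 1 by rewrite Hk row_mxEl mxE.
have bC C : C \in min_covers G -> 0 <= b C * (ray_sum (alpha k) C)%:~R.
  move=> CG; rewrite mulr_ge0 ?bge // ler0z.
  by rewrite ray_sum_facet subr_ge0 lez_nat min_cover_size.
have aC i : 0 <= a i * (alpha k 0 (lshift 1 i))%:~R by rewrite ak mulr1.
rewrite paddr_eq0 ?sumr_ge0 // !psumr_eq0 // => /andP[/allP a0 /allP b0].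
rewrite !big1 ?addr0 // => [C CG|i _].
  have := implyP (b0 C (mem_index_enum _)) CG.
  rewrite mulf_eq0 intr_eq0 ray_sum_facet subr_eq0 => /orP[/eqP->|/eqP[Cg]].
    by rewrite mul0r.
  by rewrite dC ?mulr0.
have := implyP (a0 i (mem_index_enum _)) isT.
by rewrite ak mulr1 => /eqP->; rewrite mul0r.
Qed.

(** Without vertices the only cover is empty, which forces [g = 0]; then [alpha k] is 0 and not
    primitive. *)
Lemma facet_nvertices : (0 < n)%N.
Proof.
case: (posnP n) => // n0; exfalso.
have no (i : 'I_n) : False by move: (leq_ltn_trans (leq0n i) (ltn_ord i)); lia.
have [C CG] := min_covers_neq0 G.
have g0 : g = 0%N.
  apply/eqP; rewrite -leqn0 (leq_trans (min_cover_size CG)) //.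
  by rewrite (leq_trans (max_card _)) // card_ord n0.
have [/(_ k) + _ _] := Halpha; rewrite /primitive big1 // => j _.
case: (split_ordP j) => i ->; first by case: (no i).
by rewrite Hk row_mxEr mxE g0.
Qed.

(** Otherwise the hypothesis of [facet_vanish] is vacuous, and the last coordinate would vanish on
    the whole hyperplane, which contains (g, 0, ..., 0, 1). *)
Lemma facet_min_cover : exists2 C, C \in min_covers G & #|C| = g.
Proof.
case: (pickP [pred C in min_covers G | #|C| == g]) => [C /= /andP[? /eqP]|none].
  by exists C.
exfalso; pose i0 := Ordinal facet_nvertices.
pose d : 'rV[int]_(n + 1) := row_mx 0 (const_mx 1).
pose h : 'rV[R]_(n + 1) := row_mx (g%:R *: delta_mx 0 i0) (const_mx 1).
have sum_h c : pairing h c =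
    g%:R * (c 0 (lshift 1 i0))%:~R + (c 0 (rshift n ord0))%:~R.
  rewrite pairing_lshift mul1r (bigD1 i0) //= big1 => [|j jne].
    by rewrite !mxE !eqxx mulr1 addr0.
  by rewrite !mxE eqxx (negbTE jne) mulr0 mul0r.
have : pairing h d = 0.
  apply: facet_vanish => [C CG /eqP Cg|].
    by have := none C; rewrite /= CG Cg.
  by rewrite sum_h Hk row_mxEl row_mxEr !mxE mulr1 mulrNz subrr.
rewrite sum_h row_mxEl row_mxEr !mxE mulr0 add0r => /eqP.
by rewrite oner_eq0.
Qed.

(** The functional (v, -e) vanishes on the rays spanning the facet, hence on e_i - e_j, which lies
    in the hyperplane. *)
Lemma facet_constant (v : 'I_n -> int) (e : int) :
  (forall C, C \in min_covers G -> #|C| = g -> \sum_(i in C) v i = e) ->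
  forall i j, v i = v j.
Proof.
move=> ve i j; have [->//|ij] := eqVneq i j.
pose d : 'rV[int]_(n + 1) := row_mx (\row_l v l) (const_mx (- e)).
pose h : 'rV[R]_(n + 1) := row_mx (delta_mx 0 i - delta_mx 0 j) (const_mx 0).
have sum_h c : pairing h c =
    (c 0 (lshift 1 i))%:~R - (c 0 (lshift 1 j))%:~R.
  rewrite pairing_lshift mul0r addr0 (bigD1 i) //= (bigD1 j) 1?eq_sym //=.
  rewrite big1 => [|l /andP[li lj]]; last first.
    by rewrite !mxE eqxx (negbTE li) (negbTE lj) subrr mul0r.
  rewrite !mxE !eqxx (negbTE ij) [j == i]eq_sym (negbTE ij) /=; ring.
have : pairing h d = 0.
  apply: facet_vanish => [C CG Cg|]; last first.
    by rewrite sum_h Hk !row_mxEl !mxE subrr.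
  rewrite /ray_sum row_mxEr mxE -[X in _ - X](ve C CG Cg).
  apply/eqP; rewrite subr_eq0; apply/eqP/eq_bigr => l _.
  by rewrite row_mxEl mxE.
by rewrite sum_h !row_mxEl !mxE => /eqP; rewrite subr_eq0 eqr_int => /eqP.
Qed.

End Facet.

(** * Minimal covers of iterated cones *)

Section IterCone.

Variables (n : nat) (G : sgraph n).

(** The type reads [r + n] although the base comes first in the numbering, hence the cast from
    [n + r]. *)
Definition base_vertex r (i : 'I_n) : 'I_(r + n) :=
  cast_ord (addnC n r) (lshift r i).

Definition apex r (j : 'I_r) : 'I_(r + n) :=
  cast_ord (addnC n r) (rshift n j).

Lemma iter_cone_split r (x : 'I_(r + n)) :
  (exists i, x = base_vertex r i) \/ (exists j, x = apex j).
Proof.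
have -> : x = cast_ord (addnC n r) (cast_ord (esym (addnC n r)) x).
  by rewrite cast_ordKV.
by case: (split_ordP (cast_ord (esym (addnC n r)) x)) => i ->; [left | right]; exists i.
Qed.

Lemma base_vertex_inj r : injective (base_vertex r).
Proof. by move=> i j /cast_ord_inj/lshift_inj. Qed.

Lemma base_vertex_neq_apex r i (j : 'I_r) : base_vertex r i != apex j.
Proof. by rewrite -val_eqE /=; have := ltn_ord i; lia. Qed.

Lemma iter_cone_base r i j :
  iter_cone G r (base_vertex r i) (base_vertex r j) = G i j.
Proof.
elim: r => [|r IHr] /=.
  by congr (adj _ _ _); apply: val_inj.
have lift_base l : base_vertex r.+1 l = lift ord_max (base_vertex r l).
  apply: val_inj; rewrite /= /bump leqNgt.
  by rewrite (leq_trans (ltn_ord l) (leq_addl r n)).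
by rewrite /cone_rel !lift_base !liftK.
Qed.

(** Being an apex is expressed by the index, a condition that passes unchanged to the smaller cone
    in the induction. *)
Lemma iter_cone_apexl r (x y : 'I_(r + n)) :
  (n <= x)%N -> iter_cone G r x y = (x != y).
Proof.
elim: r x y => [|r IHr] x y nx /=; first by have := ltn_ord x; lia.
rewrite /cone_rel; case: unliftP nx => [x' ->|->] nx;
  case: unliftP => [y' ->|->].
- rewrite IHr ?(inj_eq lift_inj) //; first by rewrite lift_max in nx.
- by rewrite eq_sym neq_lift.
- by rewrite neq_lift.
- by rewrite eqxx.
Qed.

Lemma iter_cone_apex r (j : 'I_r) x : iter_cone G r (apex j) x = (apex j != x).
Proof. by rewrite iter_cone_apexl //= leq_addr. Qed.

Lemma sum_iter_cone r (F : 'I_(r + n) -> nat) (C : {set 'I_(r + n)}) :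
  (\sum_(x in C) F x =
   \sum_(i | base_vertex r i \in C) F (base_vertex r i) +
   \sum_(j | apex j \in C) F (apex j))%N.
Proof.
rewrite (reindex_onto (cast_ord (addnC n r)) (cast_ord (esym (addnC n r))));
  last by move=> x _; rewrite cast_ordKV.
rewrite big_mkcond big_split_ord /= [X in _ = (X + _)%N]big_mkcond.
rewrite [X in _ = (_ + X)%N]big_mkcond /=; congr (_ + _)%N;
  by apply: eq_bigr => i _; rewrite cast_ordK eqxx andbT.
Qed.

(** [C] together with all apices: the removed vertices are exactly the base vertices outside [C]. *)
Definition cone_cover r (C : {set 'I_n}) : {set 'I_(r + n)} :=
  ~: (base_vertex r @: ~: C).

Lemma base_in_cone_cover r C i : (base_vertex r i \in cone_cover r C) = (i \in C).
Proof.
rewrite inE mem_imset; last exact: base_vertex_inj.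
by rewrite inE negbK.
Qed.

Lemma apex_in_cone_cover r C (j : 'I_r) : apex j \in cone_cover r C.
Proof.
rewrite inE; apply/imsetP => -[i _ /esym/eqP].
by rewrite (negbTE (base_vertex_neq_apex _ _)).
Qed.

Lemma base_trace_cover r (C : {set 'I_(r + n)}) :
  vertex_cover (iter_cone G r) C -> vertex_cover G (base_vertex r @^-1: C).
Proof.
move/vertex_coverP => HC; apply/vertex_coverP => i j Gij.
by rewrite !inE HC ?iter_cone_base.
Qed.

(** An apex is adjacent to every other vertex. *)
Lemma cover_missing_apex r (C : {set 'I_(r + n)}) (j : 'I_r) :
  vertex_cover (iter_cone G r) C -> apex j \notin C ->
  [set~ apex j] \subset C.
Proof.
move/vertex_coverP => HC jC; apply/subsetP => x; rewrite !inE => xj.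
have := HC (apex j) x; rewrite iter_cone_apex eq_sym xj (negbTE jC).
exact.
Qed.

Lemma apex_compl_min_cover r (j : 'I_r) :
  [set~ apex j] \in min_covers (iter_cone G r).
Proof.
rewrite inE; apply/minsetP; split.
  apply/vertex_coverP => x y; rewrite !inE; have [->|//] := eqVneq x (apex j).
  by rewrite iter_cone_apex eq_sym.
move=> B HB sB; apply/eqP; rewrite eqEsubset sB /=.
apply: cover_missing_apex HB _; apply/negP => /(subsetP sB).
by rewrite !inE eqxx.
Qed.

(** As there are no loops, the complement of a single vertex is already a cover. *)
Lemma setT_not_min_cover : (0 < n)%N -> setT \notin min_covers G.
Proof.
move=> n_gt0; pose i0 := Ordinal n_gt0; rewrite inE; apply/negP.
case/minsetP => _ /(_ [set~ i0]); rewrite subsetT => /(_ _ isT) H.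
have : i0 \in [set~ i0]; last by rewrite !inE eqxx.
rewrite H ?inE //; apply/vertex_coverP => i j; rewrite !inE.
by have [->|//] := eqVneq i i0; have [->|//] := eqVneq j i0; rewrite adj_irr.
Qed.

(** A cover [B] inside [cone_cover r C] has trace [C] on the base, by minimality of [C]. If it
    missed an apex it would contain the whole base, so that [C = setT], which is not minimal. *)
Lemma cone_cover_min_cover r C : (0 < n)%N -> C \in min_covers G ->
  cone_cover r C \in min_covers (iter_cone G r).
Proof.
move=> n_gt0 CG; move: (CG); rewrite !inE => /minsetP[/vertex_coverP HC minC].
apply/minsetP; split.
  apply/vertex_coverP => x y.
  have [[i ->]|[j ->]] := iter_cone_split x; last by rewrite apex_in_cone_cover.
  have [[k ->]|[j ->]] := iter_cone_split y; last by rewrite apex_in_cone_cover orbT.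
  by rewrite iter_cone_base !base_in_cone_cover; exact: HC.
move=> B HB sB; apply/eqP; rewrite eqEsubset sB /=.
have BC : base_vertex r @^-1: B = C.
  apply: minC; first exact: base_trace_cover.
  by apply/subsetP => i; rewrite inE => /(subsetP sB); rewrite base_in_cone_cover.
apply/subsetP => x; have [[i ->]|[j ->]] := iter_cone_split x => [|_].
  by rewrite base_in_cone_cover -BC inE.
apply: contraT => jB; suff CT : C = setT.
  by have := setT_not_min_cover n_gt0; rewrite -CT CG.
apply/setP => i; rewrite inE -BC inE (subsetP (cover_missing_apex HB jB)) //.
by rewrite !inE base_vertex_neq_apex.
Qed.

End IterCone.

(** * Weights of the cone vector and its irreducibility *)

Lemma sum_cone_cover n r (F : 'I_(r + n) -> nat) (C : {set 'I_n}) :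
  (\sum_(x in cone_cover r C) F x =
   \sum_(i in C) F (base_vertex r i) + \sum_(j < r) F (apex n j))%N.
Proof.
rewrite sum_iter_cone; congr (_ + _)%N; apply: eq_bigl => x.
  by rewrite base_in_cone_cover.
by rewrite apex_in_cone_cover.
Qed.

(** Both sides are the total over all vertices; the additive form avoids truncated subtraction. *)
Lemma sum_apex_compl n r (F : 'I_(r + n) -> nat) (j : 'I_r) :
  (\sum_(x in [set~ apex n j]) F x + F (apex n j) =
   \sum_(i < n) F (base_vertex r i) + \sum_(j < r) F (apex n j))%N.
Proof.
have := sum_iter_cone F [set: 'I_(r + n)].
under [X in _ = (X + _)%N]eq_bigl do rewrite inE.
under [X in _ = (_ + X)%N]eq_bigl do rewrite inE.
move<-; rewrite [RHS](bigD1 (apex n j)) ?inE //= addnC; congr (_ + _)%N.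
by apply: eq_bigl => x; rewrite !inE.
Qed.

Lemma cone_vector_base n g r i : cone_vector n g r (base_vertex r i) = 1%N.
Proof. by rewrite mnmE /= ltn_ord. Qed.

Lemma cone_vector_apex n g r (j : 'I_r) :
  cone_vector n g r (apex n j) = (n - g)%N.
Proof. by rewrite mnmE /= ltnNge leq_addr. Qed.

Section ConeVector.

Variables (R : realType) (n p g : nat) (G : sgraph n).
Variables (alpha : 'I_p -> 'rV[int]_(n + 1)) (k : 'I_p).
Hypothesis Halpha : irreducible_representation R G alpha.
Hypothesis Hk : alpha k = row_mx (const_mx 1) (const_mx (- g%:Z)).
Variable r : nat.
Hypothesis Hr : (1 <= r)%N.

Let b := (n + (r - 1) * (n - g))%N.

Let gn : (g <= n)%N.
Proof.
have [C CG] := min_covers_neq0 G.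
rewrite (leq_trans (min_cover_size Halpha Hk CG)) //.
by rewrite (leq_trans (max_card _)) ?card_ord.
Qed.

(** This is the weight of the cone vector on [cone_cover r C] when [C] has size [g]. *)
Let bE : b = (g + r * (n - g))%N.
Proof. by move: Hr; rewrite /b; case: (r) => // q _; rewrite subn1 /= mulSn; lia. Qed.

Let sum_base : (\sum_(i < n) cone_vector n g r (base_vertex r i) = n)%N.
Proof.
under eq_bigr do rewrite cone_vector_base.
by rewrite sum1_card card_ord.
Qed.

Let sum_apex : (\sum_(j < r) cone_vector n g r (apex n j) = r * (n - g))%N.
Proof.
under eq_bigr do rewrite cone_vector_apex.
by rewrite sum_nat_const card_ord.
Qed.

Lemma sum_cone_vector_apex_compl (j : 'I_r) :
  (\sum_(x in [set~ apex n j]) cone_vector n g r x = b)%N.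
Proof.
have := sum_apex_compl (cone_vector n g r) j.
rewrite sum_base sum_apex cone_vector_apex bE.
by move: (\sum_(x in _) _)%N (r * _)%N gn => s t; lia.
Qed.

Lemma sum_cone_vector_cone_cover (C : {set 'I_n}) :
  (\sum_(x in cone_cover r C) cone_vector n g r x = #|C| + r * (n - g))%N.
Proof.
rewrite sum_cone_cover sum_apex -sum1_card; congr (_ + _)%N.
by apply: eq_bigr => i _; rewrite cone_vector_base.
Qed.

(** A cover missing an apex contains all other vertices, of weight exactly [b]. A cover with all
    apices contains [cone_cover r D] for a minimal cover [D] of [G], and [D] has size at least
    [g]. *)
Lemma cone_vector_cover : is_cover (iter_cone G r) b (cone_vector n g r).
Proof.
split.
  move=> /mnmP/(_ (base_vertex r (Ordinal (facet_nvertices Halpha Hk)))).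
  by rewrite cone_vector_base mnm0E.
have subsum (C D : {set 'I_(r + n)}) : C \subset D ->
    (\sum_(x in C) cone_vector n g r x <= \sum_(x in D) cone_vector n g r x)%N.
  move=> /subsetP CD; apply: (sub_le_big leqnn) => // x y; exact: leq_addr.
move=> C; rewrite inE => /minsetp HC.
case: (pickP [pred j : 'I_r | apex n j \notin C]) => [j /= jC|allC].
  by rewrite -(sum_cone_vector_apex_compl j) subsum ?(cover_missing_apex HC).
have [D DG DC] := min_cover_sub (base_trace_cover HC).
apply: leq_trans (subsum (cone_cover r D) C _).
  by rewrite sum_cone_vector_cone_cover bE leq_add2r (min_cover_size Halpha Hk).
apply/subsetP => x; have [[i ->]|[j ->]] := iter_cone_split x => [|_].
  by rewrite base_in_cone_cover => /(subsetP DC); rewrite inE.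
by have /negbFE := allC j.
Qed.

(** The weights of [c] and [d] are at least [i] and [j] and add up to [i + j]. *)
Lemma cone_vector_tight (c d : 'X_{1..r + n}) (i j : nat) :
  cone_vector n g r = (c + d)%MM -> is_cover (iter_cone G r) i c ->
  is_cover (iter_cone G r) j d -> (i + j)%N = b ->
  forall C, C \in min_covers (iter_cone G r) ->
  (\sum_(x in C) cone_vector n g r x = b)%N -> (\sum_(x in C) c x = i)%N.
Proof.
move=> -> [_ ci] [_ dj] ij C CG; under eq_bigr do rewrite mnmDE.
rewrite big_split /= -ij; move: (ci C CG) (dj C CG).
by move: (\sum_(x in C) c x)%N (\sum_(x in C) d x)%N => s t; lia.
Qed.

(** With zero base part, tightness on a cone cover says that the apex entries sum to [i]; tightness
    on the complement of an apex says that they still do without that entry, so the entry is 0. *)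
Lemma cone_vector_summand (c d : 'X_{1..r + n}) (i j : nat) :
  cone_vector n g r = (c + d)%MM -> is_cover (iter_cone G r) i c ->
  is_cover (iter_cone G r) j d -> (i + j)%N = b ->
  (forall x, c (base_vertex r x) = 0%N) -> c = 0%MM.
Proof.
move=> cd ci dj ij c0; have tight := cone_vector_tight cd ci dj ij.
have [C CG Cg] := facet_min_cover Halpha Hk.
have := tight _ (cone_cover_min_cover r (facet_nvertices Halpha Hk) CG).
rewrite sum_cone_vector_cone_cover sum_cone_cover Cg bE big1 // add0n => Si.
apply/mnmP => x; rewrite mnm0E.
have [[y ->]|[l ->]] := iter_cone_split x; first exact: c0.
have := sum_apex_compl c l; rewrite (Si erefl) [X in _ = (X + _)%N]big1 // add0n.
rewrite (tight _ (apex_compl_min_cover G l) (sum_cone_vector_apex_compl l)).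
lia.
Qed.

(* The base parts of [c] and [d] are 0-1 vectors with sum 1, and are constant
   by tightness, so that one of them vanishes. *)
Lemma cone_vector_irreducible :
  irreducible_cover (iter_cone G r) b (cone_vector n g r).
Proof.
split; first exact: cone_vector_cover.
move=> [c [d [i [j [cd ci dj ij]]]]].
have n_gt0 := facet_nvertices Halpha Hk; pose x0 := Ordinal n_gt0.
have sum1 x : (c (base_vertex r x) + d (base_vertex r x) = 1)%N.
  by rewrite -mnmDE -cd cone_vector_base.
have cst x : c (base_vertex r x) = c (base_vertex r x0).
  (* A cone cover contains every apex, so on each cover of size [g] the base part of [c] sums to the
     same integer [i - S]. *)
  pose S := (\sum_(l < r) c (apex n l))%N.
  have := @facet_constant _ _ _ _ _ Halpha _ _ Hk
    (fun x => (c (base_vertex r x))%:Z) (i%:Z - S%:Z) _ x x0.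
  move=> H; suff [] : Posz (c (base_vertex r x)) = c (base_vertex r x0) by [].
  apply: H => C CG Cg; apply/eqP; rewrite eq_sym subr_eq; apply/eqP.
  have := cone_vector_tight cd ci dj ij (cone_cover_min_cover r n_gt0 CG).
  rewrite sum_cone_vector_cone_cover Cg -bE => /(_ erefl) <-.
  rewrite sum_cone_cover PoszD; congr (_ + _).
  by rewrite -natz natr_sum; apply: eq_bigr => y _; rewrite natz.
have [c0|c0] := posnP (c (base_vertex r x0)).
  by case: ci.1; apply: (cone_vector_summand cd ci dj ij) => x; rewrite cst.
(* Now [c] is positive, hence 1, on the whole base, so [d] vanishes there and the two summands
   exchange roles. *)
case: dj.1; apply: (@cone_vector_summand d c j i) => //.
- by rewrite cd addmC.
- by rewrite addnC.
by move=> x; have := sum1 x; rewrite cst; lia.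
Qed.

End ConeVector.

(** * Minimal primes of the edge ideal *)

Section CoverPrime.

Variables (K : fieldType) (m : nat).
Implicit Types (C : {set 'I_m}) (a c : 'X_{1..m}) (f : {mpoly K[m]}).

Definition weight C a := (\sum_(i in C) a i)%N.

Lemma weightD C a c : weight C (a + c)%MM = (weight C a + weight C c)%N.
Proof. by rewrite -big_split; apply: eq_bigr => i _; rewrite mnmDE. Qed.

Lemma weight_gt0P C a : reflect (exists2 i, i \in C & U_(i)%MM <= a)%MM
  (0 < weight C a)%N.
Proof.
rewrite lt0n sum_nat_eq0; apply: (iffP forallPn) => [[i]|[i iC ai]].
  by rewrite negb_imply => /andP[iC ai]; exists i; rewrite ?lep1mP.
by exists i; rewrite iC -lep1mP.
Qed.

Definition kill C : m.-tuple {mpoly K[m]} :=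
  [tuple if i \in C then 0 else 'X_i | i < m].

Lemma comp_kill_mpolyX C a :
  'X_[a] \mPo kill C = if weight C a == 0%N then 'X_[a] else 0.
Proof.
rewrite comp_mpolyX; case: posnP => [a0|/weight_gt0P[i iC]].
  rewrite [RHS]mpolyXE_id; apply: eq_bigr => i _; rewrite tnth_mktuple.
  case: ifP => // iC; move/eqP: a0; rewrite sum_nat_eq0 => /forallP/(_ i).
  by rewrite iC => /eqP ->; rewrite !expr0.
rewrite lep1mP => ai; rewrite (bigD1 i) //= tnth_mktuple iC.
by rewrite expr0n (negbTE ai) mul0r.
Qed.

(* The kernel of the substitution of 0 for the variables in [C], which is the
   ideal that they generate; this form makes primality evident. *)
Definition cover_prime C : {pred {mpoly K[m]}} :=
  [pred f | f \mPo kill C == 0].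

(** The substitution fixes the monomials free of [C] and kills the others, so nothing cancels and
    the surviving coefficients can be read off. *)
Lemma cover_primeP C f : reflect
  {in msupp f, forall a, (0 < weight C a)%N} (f \in cover_prime C).
Proof.
have fE : f \mPo kill C =
    \sum_(a <- msupp f) f@_a *: (if weight C a == 0%N then 'X_[a] else 0).
  rewrite {1}[f]mpolyE raddf_sum; apply: eq_bigr => a _.
  by rewrite /= comp_mpolyZ comp_kill_mpolyX.
rewrite inE fE; apply: (iffP eqP) => [f0 a af|fC].
  rewrite lt0n; apply/negP => /eqP a0; move: af; rewrite mcoeff_msupp.
  have := congr1 (mcoeff a) f0; rewrite raddf_sum mcoeff0 /=.
  have [af|/memN_msupp_eq0->] := boolP (a \in msupp f); last by rewrite eqxx.
  rewrite (bigD1_seq a) ?msupp_uniq //= a0 eqxx mcoeffZ mcoeffX eqxx mulr1.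
  rewrite big1 ?addr0 => [/eqP->//|c ca].
  by rewrite mcoeffZ; case: ifP; rewrite ?mcoeffX ?mcoeff0 ?(negbTE ca) mulr0.
rewrite big_seq big1 // => a /fC.
by rewrite lt0n => /negbTE ->; rewrite scaler0.
Qed.

Lemma mpolyX_cover_prime C i : ('X_i \in cover_prime C) = (i \in C).
Proof.
apply/cover_primeP/idP => [/(_ U_(i)%MM)|iC a].
  rewrite msuppX inE eqxx => /(_ isT)/weight_gt0P[j jC].
  by rewrite lep1mP mnm1E; have [->|] := eqVneq i j.
rewrite msuppX inE => /eqP ->; apply/weight_gt0P; exists i => //.
by rewrite lep1mP mnm1E eqxx.
Qed.

(** Weights add under multiplication, and each of the [k] factors contributes at least 1; the
    cofactors cannot lower the total. *)
Lemma ideal_pow_weight C k f : ideal_pow (cover_prime C) k f ->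
  {in msupp f, forall a, (k <= weight C a)%N}.
Proof.
have prod_weight l (t : 'I_l -> {mpoly K[m]}) :
    (forall j, t j \in cover_prime C) ->
    {in msupp (\prod_j t j), forall a, (l <= weight C a)%N}.
  elim: l t => [//|l IHl] t tC a; rewrite big_ord_recl => /msuppM_le.
  case/allpairsP => -[c d] /= [ct dt ->]; rewrite weightD.
  rewrite -[l.+1]add1n leq_add //; first exact: cover_primeP (tC ord0) _ ct.
  by apply: (IHl (fun j => t (lift ord0 j))) dt => j.
case=> s [sC ->] a /msupp_sum_le/flattenP[w /mapP[x]].
rewrite mem_filter => /sC[t [tC ->]] -> /msuppM_le.
case/allpairsP => -[c d] /= [_ dt ->]; rewrite weightD.
by rewrite (leq_trans (prod_weight _ _ tC _ dt)) ?leq_addl.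
Qed.

End CoverPrime.

Section SymbolicPower.

Variables (K : fieldType) (m : nat) (H : sgraph m).
Implicit Types (C : {set 'I_m}) (a c : 'X_{1..m}) (f : {mpoly K[m]}).

Lemma prime_over_cover (P : {pred {mpoly K[m]}}) :
  prime_over (edge_ideal (K := K) H) P ->
  vertex_cover H [set i | 'X_i \in P].
Proof.
case=> _ primeP IP; apply/vertex_coverP => i j Hij; rewrite !inE.
apply/primeP/IP; exists [:: (1, 'X_i * 'X_j)].
split=> [x|]; last by rewrite big_seq1 mul1r.
by rewrite inE => /eqP ->; exists i, j.
Qed.

(** The variables in a prime [Q] over the edge ideal form a cover. If [Q] lies in [cover_prime C],
    this cover is [C] by minimality, and every monomial of an element of [cover_prime C] is
    divisible by a variable in [Q]. *)
Lemma cover_prime_minimal C : C \in min_covers H ->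
  minimal_prime (edge_ideal (K := K) H) (@cover_prime K m C).
Proof.
rewrite inE => /minsetP[/vertex_coverP HC minC].
have idealC : idealr_closed (@cover_prime K m C).
  split=> [||f u v]; rewrite !inE ?raddf0 ?comp_mpoly1 ?oner_neq0 //.
  by move=> /eqP u0 /eqP v0; rewrite rmorphD rmorphM /= u0 v0 mulr0 addr0.
split=> [|Q Qover QC].
  split=> // [u v|_ [s [sI ->]]]; first by rewrite !inE rmorphM /= mulf_eq0.
  have [C0 _ CD] := idealC; elim: s sI => [|x s IHs] sI; first by rewrite big_nil.
  rewrite big_cons; apply: CD; last first.
    by apply: IHs => y ys; apply: sI; rewrite inE ys orbT.
  have [i [j [Hij ->]]] := sI x (mem_head _ _).
  have := HC i j Hij.
  by rewrite -!(mpolyX_cover_prime K) !inE rmorphM /= mulf_eq0.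
have QE : [set i | 'X_i \in Q] = C.
  apply: minC; first exact: prime_over_cover.
  by apply/subsetP => i; rewrite inE => /QC; rewrite mpolyX_cover_prime.
have [[Q0 _ QD] _ _] := Qover.
move=> f /cover_primeP fC; rewrite [f]mpolyE big_seq.
elim/big_ind: _ => // [u v uQ vQ|a /fC/weight_gt0P[i]].
  by rewrite -[u]mul1r QD.
rewrite -QE inE => iQ /submK <-.
by rewrite mpolyXD scalerAl -[_ * _]addr0 QD.
Qed.

(** * Symbolic powers and monomials of the symbolic Rees algebra *)

Lemma mpolyX_ideal_pow (P : {pred {mpoly K[m]}}) C a k :
  {in C, forall i, 'X_i \in P} -> (k <= weight C a)%N ->
  ideal_pow P k 'X_[a].
Proof.
move=> CP ka.
(* A single product with a cofactor suffices; the induction peels off one variable of [C] at a time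
   and [u] collects the rest. *)
suff [t [tP [u ->]]] : exists t : 'I_k -> {mpoly K[m]},
    (forall j, t j \in P) /\ exists u, 'X_[a] = u * \prod_j t j.
  exists [:: (u, \prod_j t j)]; split; last by rewrite big_seq1.
  by move=> x; rewrite inE => /eqP ->; exists t.
elim: k a ka => [|k IHk] a ka.
  exists (fun=> 0); split=> [[]//|]; exists 'X_[a].
  by rewrite big_ord0 mulr1.
have /weight_gt0P[i iC /submK aE] := leq_ltn_trans (leq0n k) ka.
have [|t [tP [u uE]]] := IHk (a - U_(i))%MM.
  move: ka; rewrite -{1}aE weightD [weight C U_(i)%MM](bigD1 i) //= mnm1E eqxx.
  rewrite big1 ?addn0 ?addn1 // => j /andP[_ ji].
  by rewrite mnm1E eq_sym (negbTE ji).
exists (fun j => oapp t 'X_i (unlift ord0 j)); split.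
  by move=> j; case: unliftP => [j' _|_] /=; rewrite ?tP ?CP.
exists u; rewrite big_ord_recl unlift_none /=.
under eq_bigr do rewrite liftK /=.
by rewrite -aE mpolyXD uE; ring.
Qed.

(** Each [cover_prime C] is a minimal prime and yields the inequality for [C]; conversely, every
    minimal prime contains the variables of some minimal cover. *)
Lemma symbolic_power_mpolyX k a :
  symbolic_power (edge_ideal (K := K) H) k 'X_[a] <->
  (forall C, C \in min_covers H -> (k <= \sum_(i in C) a i)%N).
Proof.
split=> [Ik C CH|ka P [Pover _]].
  apply: (ideal_pow_weight (Ik _ (cover_prime_minimal CH))).
  by rewrite msuppX mem_head.
have [C CH CP] := min_cover_sub (prime_over_cover Pover).
apply: (@mpolyX_ideal_pow _ C); last exact: ka.
by move=> i /(subsetP CP); rewrite inE.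
Qed.

Lemma symbolic_rees_monomial a b :
  symbolic_rees H (('X_[a] : {mpoly K[m]}) *: 'X^b) <->
  (forall C, C \in min_covers H -> (b <= \sum_(i in C) a i)%N).
Proof.
rewrite -symbolic_power_mpolyX; split=> [/(_ b)|Ib i].
  by rewrite coefZ coefXn eqxx mulr1.
rewrite coefZ coefXn; have [->|_] := eqVneq i b; first by rewrite mulr1.
(* The other coefficients are 0, the empty combination. *)
by rewrite mulr0 => P _; exists [::]; rewrite big_nil.
Qed.

Lemma size_rees_monomial a b :
  size (('X_[a] : {mpoly K[m]}) *: 'X^b) = b.+1.
Proof. by rewrite size_scale ?size_polyXn -?msupp_eq0 ?msuppX. Qed.

Lemma rees_monomial_inj a b c d :
  ('X_[a] : {mpoly K[m]}) *: 'X^b = 'X_[c] *: 'X^d -> a = c /\ b = d.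
Proof.
move=> E; have := congr1 (fun p : {poly _} => size p) E.
rewrite /= !size_rees_monomial => -[bd]; split=> //.
have := congr1 (fun p : {poly _} => p`_b) E.
rewrite /= !coefZ !coefXn bd eqxx !mulr1 => /(congr1 (mcoeff a)).
by rewrite !mcoeffX eqxx; have [->//|_ /eqP] := eqVneq c a; rewrite oner_eq0.
Qed.

(** Nonzero covers match monomials other than 1: if [a] is 0, the inequality for any minimal cover
    forces [b = 0]. *)
Lemma rees_monomial_cover a b :
  rees_monomial H (('X_[a] : {mpoly K[m]}) *: 'X^b) <-> is_cover H b a.
Proof.
have E1 : (1 : {poly {mpoly K[m]}}) = 'X_[0] *: 'X^0.
  by rewrite mpolyX0 scale1r expr0.
split=> [[_ ne1 /symbolic_rees_monomial Ib]|[a0 /symbolic_rees_monomial Ib]].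
  split=> // a0; apply: ne1; have [C CH] := min_covers_neq0 H.
  have := Ib C CH; rewrite a0 big1 => [|i _]; last by rewrite mnm0E.
  by rewrite leqn0 => /eqP ->; rewrite -E1.
by split=> //; [exists a, b | rewrite E1 => /rees_monomial_inj[]].
Qed.

Lemma irreducible_cover_generator a b : irreducible_cover H b a ->
  min_generator H (('X_[a] : {mpoly K[m]}) *: 'X^b).
Proof.
case=> ab irr; split; first exact/rees_monomial_cover.
move=> [g [h [gR hR]]]; have [[c [i gE]] _ _] := gR.
have [[d [j hE]] _ _] := hR.
rewrite gE in gR *; rewrite hE in hR *.
rewrite -scalerAl -scalerAr scalerA -mpolyXD -exprD => /rees_monomial_inj[aE bE].
apply: irr; exists c, d, i, j; split=> //; exact/rees_monomial_cover.
Qed.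

End SymbolicPower.

Theorem corollary3p25 (R : realType) (K : fieldType) (n : nat) (G : sgraph n)
    (g p : nat) (alpha : 'I_p -> 'rV[int]_(n + 1))
    (Halpha : irreducible_representation R G alpha)
    (k : 'I_p)
    (Hk : alpha k = row_mx (const_mx 1) (const_mx (- g%:Z)))
    (r : nat) (Hr : (1 <= r)%N) :
  irreducible_cover (iter_cone G r) (n + (r - 1) * (n - g))%N
    (cone_vector n g r) /\
  exists f : {poly {mpoly K[r + n]}},
    min_generator (iter_cone G r) f /\
    size f = (n + (r - 1) * (n - g)).+1%N.
Proof.
have irr := cone_vector_irreducible Halpha Hk Hr; split=> //.
(* The degree in t is [size f] minus 1. *)
exists ('X_[cone_vector n g r] *: 'X^(n + (r - 1) * (n - g))).
by rewrite size_rees_monomial; split=> //; exact: irreducible_cover_generator.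
Qed.
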